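(* Let $n\ge 1$ be an integer and let $X$ be an Ahlfors $n$-regular metric space. A homeomorphism $f:\mathbb{R}^n\to X$ is quasihomogeneous if and only if it is bi-Lipschitz.
   Context: $\mathbb{R}^n$ carries the Euclidean metric. For a metric space $(X,d)$, $B(x;r)=\{y\in X: d(x,y)<r\}$. Ahlfors $n$-regular: there is a constant $1\le C<\infty$ such that $C^{-1}r^n\le \mathcal{H}^n(B(x;r))\le C r^n$ for every ball $B(x;r)\subset X$, where $\mathcal{H}^n$ is $n$-dimensional Hausdorff measure. A map $f:X\to Y$ between metric spaces is bi-Lipschitz if there is $1\le L<\infty$ such that $L^{-1}d_X(x,y)\le d_Y(f(x),f(y))\le L\,d_X(x,y)$ for all $x,y\in X$. An embedding $h:X\to Y$ is quasihomogeneous if there is a homeomorphism $\eta:[0,\infty)\to[0,\infty)$ such that for every collection of four distinct points $x,y,z,w\in X$, $$\frac{d_Y(h(x),h(y))}{d_Y(h(z),h(w))}\le \eta\left(\frac{d_X(x,y)}{d_X(z,w)}\right).$$ *)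

(* Defs.v *)
From HB Require Import structures.
From mathcomp Require Import all_boot all_order all_algebra.
From mathcomp Require Import all_classical all_reals all_analysis.
From mathcomp Require Import ring lra.

Set Implicit Arguments.
Unset Strict Implicit.
Unset Printing Implicit Defensive.

Import Order.TTheory GRing.Theory Num.Theory.
Import numFieldNormedType.Exports.

Local Open Scope classical_set_scope.
Local Open Scope ring_scope.

(* [euclidean R n] is R^n with the Euclidean metric. It is an alias because the
   library's metric structure on ['rV[R]_n] comes from the sup norm. *)
Definition euclidean (R : realType) (n : nat) : Type := 'rV[R]_n.

HB.instance Definition _ (R : realType) (n : nat) :=
  Choice.on (euclidean R n).

Definition euclidean_dist (R : realType) (n : nat) (x y : 'rV[R]_n) : R :=
  Num.sqrt (\sum_(i < n) (x 0 i - y 0 i) ^+ 2).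

Section EuclideanMetric.
Context {R : realType} {n : nat}.
Implicit Types (a b : 'I_n -> R) (x y z : 'rV[R]_n).

Let sumsq_ge0 a : 0 <= \sum_i a i ^+ 2.
Proof. by apply: sumr_ge0 => i _; exact: sqr_ge0. Qed.

Lemma cauchy_schwarz_sum a b :
  (\sum_i a i * b i) ^+ 2 <= (\sum_i a i ^+ 2) * (\sum_i b i ^+ 2).
Proof.
set A := \sum_i a i ^+ 2; set B := \sum_i b i ^+ 2; set C := \sum_i a i * b i.
have [B0|Bneq0] := eqVneq B 0.
  have b0 i : b i = 0.
    move/eqP: B0; rewrite psumr_eq0 => [/allP/(_ i)|j _]; last exact: sqr_ge0.
    by rewrite mem_index_enum sqrf_eq0 => /(_ isT)/eqP.
  by rewrite /C big1 ?expr0n ?B0 ?mulr0// => i _; rewrite b0 mulr0.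
have Bgt0 : 0 < B by rewrite lt_neqAle eq_sym Bneq0 sumsq_ge0.
have : 0 <= \sum_i (B * a i - C * b i) ^+ 2 by exact: sumsq_ge0.
have -> : \sum_i (B * a i - C * b i) ^+ 2 = B * (A * B - C ^+ 2).
  transitivity (B ^+ 2 * A - (2 * B * C) * C + C ^+ 2 * B); last by ring.
  have -> : B ^+ 2 * A = \sum_i B ^+ 2 * a i ^+ 2 by rewrite mulr_sumr.
  have -> : 2 * B * C * C = \sum_i 2 * B * C * (a i * b i) by rewrite -mulr_sumr.
  have -> : C ^+ 2 * B = \sum_i C ^+ 2 * b i ^+ 2 by rewrite mulr_sumr.
  by rewrite -sumrB -big_split/=; apply: eq_bigr => i _; ring.
by rewrite pmulr_rge0// subr_ge0.
Qed.

Lemma minkowski_sum a b :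
  Num.sqrt (\sum_i (a i + b i) ^+ 2) <=
  Num.sqrt (\sum_i a i ^+ 2) + Num.sqrt (\sum_i b i ^+ 2).
Proof.
set A := \sum_i a i ^+ 2; set B := \sum_i b i ^+ 2.
rewrite -[leRHS]ger0_norm ?addr_ge0 ?sqrtr_ge0// -sqrtr_sqr.
rewrite ler_wsqrtr// sqrrD !sqr_sqrtr ?sumsq_ge0//.
have -> : \sum_i (a i + b i) ^+ 2 = A + (\sum_i a i * b i) *+ 2 + B.
  rewrite -sumrMnl -!big_split/=.
  by apply: eq_bigr => i _; rewrite sqrrD.
rewrite lerD2r lerD2l lerMn2r/= -sqrtrM ?sumsq_ge0//.
apply: le_trans (ler_norm _) _; rewrite -sqrtr_sqr ler_wsqrtr//.
exact: cauchy_schwarz_sum.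
Qed.

Lemma euclidean_distxx x : euclidean_dist x x = 0.
Proof.
by rewrite /euclidean_dist big1 ?sqrtr0// => i _; rewrite subrr expr0n.
Qed.

Lemma euclidean_dist_positivity x y : euclidean_dist x y = 0 -> x = y.
Proof.
move=> /eqP; rewrite sqrtr_eq0 => d0; apply/rowP => i.
have /eqP : \sum_j (x 0 j - y 0 j) ^+ 2 = 0 by apply: le_anti; rewrite d0/=.
rewrite psumr_eq0 => [/allP/(_ i)|j _]; last exact: sqr_ge0.
by rewrite mem_index_enum sqrf_eq0 subr_eq0 => /(_ isT)/eqP.
Qed.

Lemma euclidean_dist_sym x y : euclidean_dist x y = euclidean_dist y x.
Proof.
by congr Num.sqrt; apply: eq_bigr => i _; rewrite -sqrrN opprB.
Qed.

Lemma euclidean_dist_triangle y x z :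
  euclidean_dist x z <= euclidean_dist x y + euclidean_dist y z.
Proof.
rewrite /euclidean_dist.
under eq_bigr => i _ do rewrite -(subrKA (y 0 i)).
exact: minkowski_sum.
Qed.

End EuclideanMetric.

HB.instance Definition _ (R : realType) (n : nat) :=
  @isMetric.Build R (euclidean R n) (@euclidean_dist R n) euclidean_distxx
    euclidean_dist_positivity euclidean_dist_sym euclidean_dist_triangle.

(* [f] restricts to a homeomorphism from the subspace [A] onto the subspace
   [B]; its values outside [A] are irrelevant. *)
Definition homeomorphism_on (X Y : topologicalType) (A : set X) (B : set Y)
    (f : X -> Y) : Prop :=
  exists g : Y -> X,
    [/\ set_fun A B f, set_fun B A g,
        {in A, cancel f g}, {in B, cancel g f} &
        {within A, continuous f} /\ {within B, continuous g}].

Definition homeomorphism (X Y : topologicalType) (f : X -> Y) : Prop :=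
  homeomorphism_on setT setT f.

Definition embedding (X Y : topologicalType) (f : X -> Y) : Prop :=
  homeomorphism_on setT (range f) f.

Definition bilipschitz (R : realType) (X Y : metricType R) (f : X -> Y) : Prop :=
  exists2 L : R, 1 <= L &
    forall x y : X, L^-1 * mdist x y <= mdist (f x) (f y) <= L * mdist x y.

Definition quasihomogeneous (R : realType) (X Y : metricType R) (h : X -> Y) :
    Prop :=
  embedding h /\
  exists2 eta : R -> R,
    homeomorphism_on (`[0, +oo[%classic : set R) (`[0, +oo[%classic : set R)
      eta &
    forall x y z w : X, uniq [:: x; y; z; w] ->
      mdist (h x) (h y) / mdist (h z) (h w) <= eta (mdist x y / mdist z w).

Section Hausdorff.
Context {R : realType} {X : metricType R}.
Local Open Scope ereal_scope.

(* The extra [0] only matters for [A = set0], whose diameter is then [0]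
   instead of [-oo]. *)
Definition diam (A : set X) : \bar R :=
  ereal_sup (0 |` [set (mdist p.1 p.2)%:E | p in A `*` A]).

(* Countable covers are sequences of sets, possibly empty from some point on;
   an empty set contributes [0] to the sum as soon as [n] is positive. *)
Definition hausdorff_content (n : nat) (delta : R) (A : set X) : \bar R :=
  ereal_inf [set \sum_(0 <= i <oo) diam (E i) ^+ n | E in
    [set E : (set X)^nat | A `<=` \bigcup_i E i /\
                           forall i, diam (E i) <= delta%:E]].

(* Hausdorff (outer) measure, without a normalizing factor: such a factor is a
   positive constant depending only on [n], so that it has no influence on
   Ahlfors regularity. *)
Definition hausdorff_measure (n : nat) (A : set X) : \bar R :=
  ereal_sup [set hausdorff_content n delta A | delta in
    [set delta : R | (0 < delta)%R]].

End Hausdorff.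

(* All radii are allowed, so that [X] is necessarily unbounded when it is
   nonempty and [n] is positive. *)
Definition ahlfors_regular (R : realType) (n : nat) (X : metricType R) : Prop :=
  exists2 C : R, 1 <= C &
    forall (x : X) (r : R), 0 < r ->
      ((C^-1 * r ^+ n)%:E <= hausdorff_measure n (ball x r) <=
       (C * r ^+ n)%:E)%E.

(* Main.v *)
Require Import Defs.
From mathcomp Require Import all_boot all_order all_algebra.
From mathcomp Require Import all_classical all_reals all_analysis.
From mathcomp Require Import ring lra.

Set Implicit Arguments.
Unset Strict Implicit.
Unset Printing Implicit Defensive.

Import Order.TTheory GRing.Theory Num.Theory.
Import numFieldNormedType.Exports.

Local Open Scope classical_set_scope.
Local Open Scope ring_scope.

(** That a bi-Lipschitz map is quasihomogeneous is immediate: the ratio of two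
    distances changes by a factor at most [L ^ 2], so [eta t = L ^ 2 * t] works.

    For the converse, let [f] be quasihomogeneous and let [phi r] be the
    distance between the images of a fixed pair of points at distance [r].
    Since [eta] is bounded on [[0, 2 n]], there is a constant [A] such that
    [d (f x) (f y) <= A * d (f z) (f w)] as soon as [|x - y| <= 2 n |z - w|]
    ([quasihomogeneous_compare]). In particular [d (f x) (f y)] agrees with
    [phi |x - y|] up to the factor [A], and everything comes down to showing
    that [phi] grows linearly. This is where the measure enters, through the
    cube of side [N r] cut into [N ^ n] cubes of side [r]:
    - the image of the large cube contains a ball of radius about [phi (N r)],
      and the image of each small cube lies in a ball of radius about [phi r];
      by Ahlfors regularity and subadditivity of Hausdorff measure,
      [phi (N r) ^ n] is at most a constant times [N ^ n * phi r ^ n]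
      ([image_scale_mul_le]);
    - the images of the grid points are the centers of balls of radius about
      [phi r] that stay at a positive distance from one another, and all of them
      lie in a ball of radius about [phi (N r)]; Hausdorff measure being
      superadditive on separated sets, [N ^ n * phi r ^ n] is at most a constant
      times [phi (N r) ^ n] ([mul_image_scale_le]).

    Hence [phi (N r)] is comparable to [N * phi r], with constants that do not
    depend on [N] and [r], and taking for [N] the integer part of a ratio of
    scales gives linear growth ([image_scale_linear]). *)

(** * Additivity properties of Hausdorff measure *)

Section HausdorffMeasure.
Context {R : realType} {X : metricType R}.
Local Open Scope ereal_scope.
Implicit Types (A B : set X) (n : nat) (delta : R).

Lemma diam_ge0 A : 0 <= diam A.
Proof. by apply: ereal_sup_ubound; left. Qed.

Lemma diam_mono A B : A `<=` B -> diam A <= diam B.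
Proof.
move=> AB; apply: ereal_sup_le => x [->|[p [Ap1 Ap2] <-]]; first by left.
by right; exists p => //; split; exact: AB.
Qed.

Lemma diam_set0 : diam (set0 : set X) = 0.
Proof.
apply/le_anti; rewrite diam_ge0 andbT; apply: ge_ereal_sup => x [->//|].
by move=> [p [[]]].
Qed.

Lemma dist_le_diam A x y : A x -> A y -> (mdist x y)%:E <= diam A.
Proof. by move=> Ax Ay; apply: ereal_sup_ubound; right; exists (x, y). Qed.

Lemma le_expe n (x y : \bar R) : 0 <= x -> x <= y -> x ^+ n <= y ^+ n.
Proof.
move=> x0 xy; elim: n => [|n ih]; first by rewrite !expe0.
by rewrite !expeS lee_pmul// expe_ge0.
Qed.

Let diamX_ge0 n A : 0 <= diam A ^+ n.
Proof. exact/expe_ge0/diam_ge0. Qed.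

Let diamX_set0 n : (0 < n)%N -> diam (set0 : set X) ^+ n = 0.
Proof. by case: n => // n _; rewrite diam_set0 expeS mul0e. Qed.

Lemma hausdorff_content_ge0 n delta A : 0 <= hausdorff_content n delta A.
Proof.
apply: le_ereal_inf_tmp => x [E _ <-].
by apply: nneseries_ge0 => i _ _; exact: diamX_ge0.
Qed.

Lemma hausdorff_content_mono n delta A B : A `<=` B ->
  hausdorff_content n delta A <= hausdorff_content n delta B.
Proof.
move=> AB; apply: le_ereal_inf_tmp => x [E [BE dE] <-].
by apply: ereal_inf_lbound; exists E => //; split=> //; exact: subset_trans BE.
Qed.

Lemma hausdorff_content_anti n (delta delta' : R) A : (delta' <= delta)%R ->
  hausdorff_content n delta A <= hausdorff_content n delta' A.
Proof.
move=> dd; apply: le_ereal_inf_tmp => x [E [AE dE] <-].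
apply: ereal_inf_lbound; exists E => //; split=> // i.
by rewrite (le_trans (dE i))// lee_fin.
Qed.

Lemma content_le_hausdorff_measure n delta A : (0 < delta)%R ->
  hausdorff_content n delta A <= hausdorff_measure n A.
Proof. by move=> d0; apply: ereal_sup_ubound; exists delta. Qed.

Lemma hausdorff_measure_ge0 n A : 0 <= hausdorff_measure n A.
Proof.
apply: le_trans (hausdorff_content_ge0 n 1%R A) _.
exact: content_le_hausdorff_measure.
Qed.

Lemma hausdorff_measure_mono n A B : A `<=` B ->
  hausdorff_measure n A <= hausdorff_measure n B.
Proof.
move=> AB; apply: ge_ereal_sup => x [d d0 <-].
apply: le_trans (hausdorff_content_mono n d AB) _.
exact: content_le_hausdorff_measure.
Qed.

(** Used to merge a cover of [A] and a cover of [B] into a cover of their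
    union. *)
Definition interleave T (E F : nat -> T) (i : nat) : T :=
  if odd i then F i./2 else E i./2.

Lemma sum_interleave (u v : (\bar R)^nat) m :
  \sum_(0 <= i < m.*2) interleave u v i =
  \sum_(0 <= i < m) u i + \sum_(0 <= i < m) v i.
Proof.
elim: m => [|m ih]; first by rewrite !big_geq// adde0.
rewrite doubleS !big_nat_recr//= ih /interleave/= odd_double/= uphalf_double.
by rewrite doubleK [RHS]addeACA addeA.
Qed.

Lemma nneseries_interleave (u v : (\bar R)^nat) :
  (forall i, 0 <= u i) -> (forall i, 0 <= v i) ->
  \sum_(0 <= i <oo) interleave u v i <=
  \sum_(0 <= i <oo) u i + \sum_(0 <= i <oo) v i.
Proof.
move=> u0 v0.
have w0 i : 0 <= interleave u v i by rewrite /interleave; case: ifP.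
apply: lime_le; first by apply: is_cvg_nneseries => i _ _.
apply: nearW => m.
apply: (@le_trans _ _ (\sum_(0 <= i < m.*2) interleave u v i)).
  by apply: lee_sum_nneg_natr => //; rewrite -addnn leq_addr.
by rewrite sum_interleave leeD//; apply: nneseries_lim_ge => i _ _.
Qed.

Lemma hausdorff_contentU n delta A B :
  hausdorff_content n delta (A `|` B) <=
  hausdorff_content n delta A + hausdorff_content n delta B.
Proof.
have A0 := hausdorff_content_ge0 n delta A.
have B0 := hausdorff_content_ge0 n delta B.
have [->|Afin] := eqVneq (hausdorff_content n delta A) +oo.
  by rewrite addye ?leey// gt_eqF// (lt_le_trans _ B0).
have [->|Bfin] := eqVneq (hausdorff_content n delta B) +oo.
  by rewrite addey ?leey// gt_eqF// (lt_le_trans _ A0).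
have Anum : hausdorff_content n delta A \is a fin_num.
  by rewrite ge0_fin_numE// ltey.
have Bnum : hausdorff_content n delta B \is a fin_num.
  by rewrite ge0_fin_numE// ltey.
apply/lee_addgt0Pr => e e0; have e20 : (0 < e / 2)%R by rewrite divr_gt0.
have [_ [E [AE dE] <-] /ltW lE] := lb_ereal_inf_adherent e20 Anum.
have [_ [F [BF dF] <-] /ltW lF] := lb_ereal_inf_adherent e20 Bnum.
rewrite [e]splitr EFinD addeACA; apply: le_trans (leeD lE lF).
apply: le_trans (nneseries_interleave _ _) => //; apply: ereal_inf_lbound.
exists (interleave E F); last first.
  by apply: eq_eseriesr => i _; rewrite /interleave; case: ifP.
split=> [x [/AE[i _ Ei]|/BF[i _ Fi]]|i].
- by exists i.*2 => //; rewrite /interleave odd_double doubleK.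
- by exists i.*2.+1 => //; rewrite /interleave /= odd_double/= uphalf_double.
- by rewrite /interleave; case: ifP.
Qed.

Lemma hausdorff_measureU n A B :
  hausdorff_measure n (A `|` B) <=
  hausdorff_measure n A + hausdorff_measure n B.
Proof.
apply: ge_ereal_sup => x [d d0 <-].
apply: le_trans (hausdorff_contentU n d A B) _.
by rewrite leeD// content_le_hausdorff_measure.
Qed.

Lemma hausdorff_measure0 n : (0 < n)%N ->
  hausdorff_measure n (set0 : set X) = 0.
Proof.
move=> n0; apply/le_anti; rewrite hausdorff_measure_ge0 andbT.
apply: ge_ereal_sup => x [d d0 <-]; apply: ereal_inf_lbound.
exists (fun=> set0).
  by split=> // i; rewrite diam_set0 lee_fin ltW.
by apply: eseries0 => i _ _; rewrite diamX_set0.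
Qed.

Lemma hausdorff_measure_bigcup_le n (I : choiceType) (s : seq I)
    (A : I -> set X) : (0 < n)%N ->
  hausdorff_measure n (\bigcup_(i in [set` s]) A i) <=
  \sum_(i <- s) hausdorff_measure n (A i).
Proof.
move=> n0; elim: s => [|i s ih]; first
  by rewrite set_nil bigcup_set0 big_nil hausdorff_measure0.
rewrite big_cons; apply: le_trans (leeD2l _ ih).
apply: le_trans (hausdorff_measureU n _ _).
by apply: hausdorff_measure_mono; rewrite !bigcup_seq big_cons.
Qed.

(** Only sets of small diameter matter in the limit, and a set of diameter less
    than the gap between [A] and [B] meets only one of them; so a fine cover of
    the union splits into a cover of [A] and a cover of [B]. *)
Lemma hausdorff_measureU_separated n (sep : R) A B : (0 < n)%N -> (0 < sep)%R ->
  (forall x y, A x -> B y -> (sep <= mdist x y)%R) ->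
  hausdorff_measure n A + hausdorff_measure n B <=
  hausdorff_measure n (A `|` B).
Proof.
move=> n0 sep0 sepAB; set M := hausdorff_measure n (A `|` B).
(* The two contents are taken at independent scales, so that the suprema
   defining the two measures can be reached separately afterwards. *)
have content_le d1 d2 : (0 < d1)%R -> (0 < d2)%R ->
    hausdorff_content n d1 A + hausdorff_content n d2 B <= M.
  move=> d10 d20; pose d := (Num.min (Num.min d1 d2) (sep / 2))%R.
  have d0 : (0 < d)%R by rewrite !lt_min d10 d20 divr_gt0.
  have dd1 : (d <= d1)%R by rewrite !ge_min lexx.
  have dd2 : (d <= d2)%R by rewrite !ge_min lexx orbT.
  have dsep : (d < sep)%R.
    by rewrite !gt_min; apply/orP; right; rewrite ltr_pdivrMr// ltr_pMr// ltr1n.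
  apply: le_trans (content_le_hausdorff_measure n (A `|` B) d0).
  apply: le_trans (leeD (hausdorff_content_anti n A dd1)
                        (hausdorff_content_anti n B dd2)) _.
  apply: le_ereal_inf_tmp => x [E [ABE dE] <-].
  apply: (@le_trans _ _ (\sum_(0 <= i <oo) diam (E i `&` A) ^+ n +
                         \sum_(0 <= i <oo) diam (E i `&` B) ^+ n)).
    apply: leeD; apply: ereal_inf_lbound.
      exists (fun i => E i `&` A) => //; split=> [y Ay|i].
        by have [i _ Ei] := ABE y (or_introl Ay); exists i.
      exact: le_trans (diam_mono (@subIsetl _ _ _)) (dE i).
    exists (fun i => E i `&` B) => //; split=> [y By|i].
      by have [i _ Ei] := ABE y (or_intror By); exists i.
    exact: le_trans (diam_mono (@subIsetl _ _ _)) (dE i).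
  rewrite -nneseriesD//; apply: lee_nneseries => [i _ _|i _].
    exact: adde_ge0.
  have [->|/set0P[y [Ey Ay]]] := eqVneq (E i `&` A) set0.
    rewrite diamX_set0// add0e le_expe//.
      exact: diam_ge0.
    exact: (diam_mono (@subIsetl _ _ _)).
  have -> : E i `&` B = set0.
    rewrite -subset0 => z [Ez Bz].
    have := le_trans (dist_le_diam Ey Ez) (dE i).
    by rewrite lee_fin leNgt (lt_le_trans dsep)// sepAB.
  rewrite diamX_set0// adde0 le_expe//.
    exact: diam_ge0.
  exact: (diam_mono (@subIsetl _ _ _)).
have [->|Mfin] := eqVneq M +oo; first by rewrite leey.
have fin_content d1 : (0 < d1)%R -> hausdorff_content n d1 B \is a fin_num.
  move=> d10; rewrite ge0_fin_numE ?hausdorff_content_ge0//.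
  apply: (@le_lt_trans _ _ M); last by rewrite ltey.
  apply: le_trans (content_le 1%R d1 ltr01 d10).
  by rewrite leeDr// hausdorff_content_ge0.
have HA d2 : (0 < d2)%R ->
    hausdorff_measure n A + hausdorff_content n d2 B <= M.
  move=> d20; rewrite -leeBrDr ?fin_content//.
  apply: ge_ereal_sup => x [d1 d10 <-]; rewrite leeBrDr ?fin_content//.
  exact: content_le.
have HAfin : hausdorff_measure n A \is a fin_num.
  rewrite ge0_fin_numE ?hausdorff_measure_ge0//.
  apply: (@le_lt_trans _ _ M); last by rewrite ltey.
  by apply: le_trans (HA 1%R ltr01); rewrite leeDl// hausdorff_content_ge0.
rewrite -leeBrDl//; apply: ge_ereal_sup => x [d2 d20 <-].
by rewrite leeBrDl// HA.
Qed.

Lemma hausdorff_measure_bigcup_separated n (I : choiceType) (s : seq I)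
    (A : I -> set X) (sep : R) : (0 < n)%N -> (0 < sep)%R -> uniq s ->
  (forall i j x y, i != j -> A i x -> A j y -> (sep <= mdist x y)%R) ->
  \sum_(i <- s) hausdorff_measure n (A i) <=
  hausdorff_measure n (\bigcup_(i in [set` s]) A i).
Proof.
move=> n0 sep0 us sepA; elim: s us => [_|i s ih /= /andP[is_ us]].
  by rewrite big_nil hausdorff_measure_ge0.
rewrite big_cons; apply: le_trans (leeD2l _ (ih us)) _.
apply: le_trans (hausdorff_measureU_separated n0 sep0 _) _.
  move=> x y Aix [j /= js Ajy]; apply: sepA Aix Ajy.
  by apply: contraNneq is_ => ->.
by apply: hausdorff_measure_mono; rewrite !bigcup_seq big_cons.
Qed.

End HausdorffMeasure.

(** * Coordinates in Euclidean space *)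

Section EuclideanCoordinates.
Context {R : realType} {n : nat}.
Implicit Types (x y : 'rV[R]_n).

Lemma coord_le_euclidean_dist x y i : `|x 0 i - y 0 i| <= euclidean_dist x y.
Proof.
rewrite -sqrtr_sqr ler_wsqrtr// (bigD1 i)//= lerDl.
by apply: sumr_ge0 => j _; exact: sqr_ge0.
Qed.

Lemma euclidean_dist_le_coord x y b : (0 < n)%N ->
  (forall i, `|x 0 i - y 0 i| <= b) -> euclidean_dist x y <= n%:R * b.
Proof.
move=> n0 xyb; have b0 : 0 <= b by exact: le_trans (xyb (Ordinal n0)).
rewrite -[leRHS]ger0_norm ?mulr_ge0// -sqrtr_sqr ler_wsqrtr//.
apply: (@le_trans _ _ (\sum_(i < n) b ^+ 2)).
  by apply: ler_sum => i _; rewrite -real_normK ?num_real// lerXn2r ?nnegrE.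
rewrite sumr_const card_ord -[leLHS]mulr_natl exprMn ler_wpM2r ?sqr_ge0//.
by rewrite expr2 ler_peMl// ler1n.
Qed.

Definition axis_point (i : 'I_n) (t : R) : 'rV[R]_n := t *: delta_mx 0 i.

Lemma axis_pointE i t : axis_point i t 0 i = t.
Proof. by rewrite !mxE !eqxx mulr1. Qed.

Lemma dist_axis_point i s t :
  euclidean_dist (axis_point i s) (axis_point i t) = `|s - t|.
Proof.
rewrite /euclidean_dist (bigD1 i)//= big1 ?addr0 => [|j ji].
  by rewrite !axis_pointE sqrtr_sqr.
by rewrite !mxE (negbTE ji) andbF !mulr0 subrr expr0n.
Qed.

(** A segment of the first coordinate axis, pushed beyond every point of [s]. *)
Lemma exists_pair_at_dist (s : seq 'rV[R]_n) t : (0 < n)%N -> 0 <= t ->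
  exists u v, [/\ u \notin s, v \notin s & euclidean_dist u v = t].
Proof.
move=> n0 t0; pose i := Ordinal n0; pose M : R := 1 + \sum_(x <- s) `|x 0 i|.
have far (m : R) : M <= m -> axis_point i m \notin s.
  move=> Mm; apply/negP => ms; suff : m < M by rewrite ltNge Mm.
  rewrite /M (big_rem _ ms)/= axis_pointE.
  have : 0 <= \sum_(y <- rem (axis_point i m) s) `|y 0 i| by apply: sumr_ge0.
  by have := ler_norm m; lra.
exists (axis_point i M), (axis_point i (M + t)).
split; [exact: far|by apply: far; rewrite lerDl|].
by rewrite dist_axis_point opprD addrA subrr sub0r normrN ger0_norm.
Qed.

Definition grid_point N (r : R) (k : {ffun 'I_n -> 'I_N}) : 'rV[R]_n :=
  \row_i (r * (k i)%:R).

Lemma dist_grid_ge N r (k l : {ffun 'I_n -> 'I_N}) : 0 <= r -> k != l ->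
  r <= euclidean_dist (grid_point r k) (grid_point r l).
Proof.
move=> r0 kl; have [i kli] : exists i, k i != l i.
  apply/existsP; apply: contraR kl; rewrite negb_exists => /forallP kl.
  by apply/eqP/ffunP => i; apply/eqP; have := kl i; rewrite negbK.
apply: le_trans (coord_le_euclidean_dist _ _ i); rewrite !mxE -mulrBr normrM.
rewrite (ger0_norm r0) ler_peMr//.
have : (k i < l i)%N || (l i < k i)%N by rewrite -neq_ltn.
wlog lt_kl : k l {kl kli} / (k i < l i)%N => [ih|_].
  by case/orP=> h; [|rewrite distrC]; apply: ih; rewrite ?h.
rewrite distrC ger0_norm ?subr_ge0 ?ler_nat 1?ltnW// lerBrDl.
by rewrite natr1 ler_nat.
Qed.

Lemma dist_grid_origin N r (k : {ffun 'I_n -> 'I_N}) : (0 < n)%N -> 0 <= r ->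
  euclidean_dist 0 (grid_point r k) <= n%:R * (N%:R * r).
Proof.
move=> n0 r0; apply: euclidean_dist_le_coord => // i; rewrite !mxE sub0r normrN.
by rewrite ger0_norm ?mulr_ge0// mulrC ler_wpM2r// ler_nat ltnW.
Qed.

(** A point of the cube of side [N r] with corner at the origin is close to the
    grid point obtained by rounding its coordinates down. The ball inscribed in
    that cube is used instead of the cube, since a map is controlled on it by
    distances to the center. *)
Lemma grid_approx N r x : (0 < n)%N -> 0 < r ->
  euclidean_dist x (const_mx (N%:R * r / 2)) < N%:R * r / 2 ->
  exists k : {ffun 'I_n -> 'I_N},
    euclidean_dist x (grid_point r k) <= n%:R * r.
Proof.
move=> n0 r0 xc.
have x_itv i : 0 < x 0 i < N%:R * r.
  have := le_lt_trans (coord_le_euclidean_dist x _ i) xc.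
  by rewrite mxE ltr_norml => /andP[? ?]; apply/andP; split; lra.
have xr0 i : 0 <= x 0 i / r by rewrite divr_ge0 ?ltW//; case/andP: (x_itv i).
have xN (i : 'I_n) : (Num.truncn (x 0 i / r)%R < N)%N.
  by rewrite truncn_lt_nat// ltr_pdivrMr//; case/andP: (x_itv i).
exists [ffun i => Ordinal (xN i)]; apply: euclidean_dist_le_coord => // i.
rewrite !mxE ffunE/=.
have /andP[lo hi] := truncn_itv (xr0 i).
move: lo hi; rewrite ler_pdivlMr// ltr_pdivrMr// -natr1 => lo hi.
by rewrite ler_norml; apply/andP; split; lra.
Qed.

End EuclideanCoordinates.

(** * Comparing distances under a quasihomogeneous map *)

(** The four points of the defining inequality have to be distinct; going
    through a far away pair at distance [mdist x y] removes this restriction,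
    at the cost of squaring the constant. *)
Lemma quasihomogeneous_compare (R : realType) n (X : metricType R)
    (f : euclidean R n -> X) (K : R) : (0 < n)%N -> 1 <= K ->
  quasihomogeneous f ->
  exists2 A : R, 1 <= A & forall x y z w : euclidean R n,
    mdist x y <= K * mdist z w -> mdist (f x) (f y) <= A * mdist (f z) (f w).
Proof.
move=> n0 K1 [[g [_ _ fK _ _]] [eta [_ [_ _ _ _ [eta_cont _]]] eta_le]].
have f_inj : injective f.
  by move=> x y fxy; rewrite -(fK x) ?inE// fxy fK ?inE.
have K0 : 0 <= K by exact: le_trans K1.
have [|c _ eta_max] := @EVT_max _ eta 0 K K0.
  apply: continuous_subspaceW eta_cont => x /=.
  by rewrite !in_itv/= andbT => /andP[].
pose B := Num.max 1 (eta c); have B1 : 1 <= B by rewrite le_max lexx.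
have B0 : 0 <= B by exact: le_trans B1.
have distinct x y z w : uniq [:: x; y; z; w] -> mdist x y <= K * mdist z w ->
    mdist (f x) (f y) <= B * mdist (f z) (f w).
  move=> u xyzw; have zw : z != w.
    by move: u => /= /and4P[_ _]; rewrite inE.
  have fzw0 : 0 < mdist (f z) (f w) by rewrite mdist_gt0 (inj_eq f_inj).
  rewrite -ler_pdivrMr//; apply: le_trans (eta_le _ _ _ _ u) _.
  rewrite le_max; apply/orP; right; apply: eta_max.
  by rewrite in_itv/= divr_ge0 ?mdist_ge0//= ler_pdivrMr// mdist_gt0.
exists (B * B); first by rewrite mulr_ege1.
move=> x y z w xyzw; have [->|xy] := eqVneq x y.
  by rewrite mdistxx !mulr_ge0 ?mdist_ge0.
have xy0 : 0 < mdist x y by rewrite mdist_gt0.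
have zw : z != w.
  by apply: contraTneq xyzw => ->; rewrite mdistxx mulr0 -ltNge.
have [u [v [us vs uv]]] :=
  exists_pair_at_dist ([:: x; y; z; w] : seq 'rV[R]_n) n0 (ltW xy0).
have {}uv : mdist (u : euclidean R n) v = mdist x y by [].
have uv' : (u : euclidean R n) != v by rewrite -mdist_gt0 uv.
move: us vs; rewrite !inE !negb_or => /and4P[ux uy uz uw] /and4P[vx vy vz vw].
rewrite -mulrA; apply: (@le_trans _ _ (B * mdist (f u) (f v))).
  apply: distinct; last by rewrite uv ler_peMl// ltW.
  by rewrite /= !inE !negb_or xy uv' !(eq_sym x) !(eq_sym y) ux uy vx vy.
rewrite ler_wpM2l//; apply: distinct; last by rewrite uv.
by rewrite /= !inE !negb_or uv' zw uz uw vz vw.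
Qed.

(** * Linear growth of distances *)

(** Extracting an [n]-th root without naming it: for [1 <= C] the [n]-th root of
    [C] is at most [C]. *)
Lemma ler_root_bound (R : realType) n (C a b : R) : (0 < n)%N -> 1 <= C ->
  0 <= a -> 0 <= b -> a ^+ n <= C * b ^+ n -> a <= C * b.
Proof.
move=> n0 C1 a0 b0 ab; have C0 : 0 <= C by exact: le_trans C1.
rewrite -(@ler_pXn2r _ n)// ?nnegrE ?mulr_ge0//; apply: le_trans ab _.
by rewrite exprMn ler_wpM2r ?exprn_ge0// ler_eXnr.
Qed.

Section LinearGrowth.
Context {R : realType} {n : nat} {X : metricType R}.
Context (f : euclidean R n -> X) (A C : R) (n0 : (0 < n)%N).
Context (A1 : 1 <= A) (C1 : 1 <= C) (f_inj : injective f)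
  (f_surj : forall y, exists x, f x = y).
Context (f_compare : forall x y z w : euclidean R n,
  mdist x y <= (2 * n)%:R * mdist z w ->
  mdist (f x) (f y) <= A * mdist (f z) (f w)).
Context (mu_ball : forall (x : X) r, 0 < r ->
  ((C^-1 * r ^+ n)%:E <= hausdorff_measure n (ball x r) <= (C * r ^+ n)%:E)%E).

(** The size of the image of a pair at distance [r]; any other pair at distance
    [r] gives the same size up to the factor [A]. *)
Definition image_scale (r : R) : R :=
  mdist (f (axis_point (Ordinal n0) 0)) (f (axis_point (Ordinal n0) r)).
Local Notation phi := image_scale.

Let A0 : 0 < A. Proof. exact: lt_le_trans A1. Qed.
Let C0 : 0 < C. Proof. exact: lt_le_trans C1. Qed.

Let dist_axis (r : R) : 0 <= r ->
  mdist (axis_point (Ordinal n0) 0 : euclidean R n) (axis_point (Ordinal n0) r)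
  = r.
Proof. by move=> r0; rewrite [LHS]dist_axis_point sub0r normrN ger0_norm. Qed.

Lemma image_scale_ge0 r : 0 <= phi r.
Proof. exact: mdist_ge0. Qed.

Lemma image_scale_gt0 r : 0 < r -> 0 < phi r.
Proof.
by move=> r0; rewrite mdist_gt0 (inj_eq f_inj) -mdist_gt0 dist_axis// ltW.
Qed.

Lemma le_image_scale (x y : euclidean R n) r : 0 <= r ->
  mdist x y <= (2 * n)%:R * r -> mdist (f x) (f y) <= A * phi r.
Proof. by move=> r0 xy; apply: f_compare; rewrite dist_axis. Qed.

Lemma image_scale_le (x y : euclidean R n) r : 0 <= r ->
  r <= (2 * n)%:R * mdist x y -> phi r <= A * mdist (f x) (f y).
Proof. by move=> r0 xy; apply: f_compare; rewrite dist_axis. Qed.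

Lemma image_scale_le2 r s : 0 <= r -> 0 <= s -> r <= (2 * n)%:R * s ->
  phi r <= A * phi s.
Proof. by move=> r0 s0 rs; apply: le_image_scale => //; rewrite dist_axis. Qed.

Let le_dim (a b : R) : 0 <= b -> a <= 2 * b -> a <= (2 * n)%:R * b.
Proof.
move=> b0 /le_trans; apply; apply: ler_wpM2r => //.
by rewrite natrM ler_peMr// ler1n.
Qed.

Let grid_card N : #|{ffun 'I_n -> 'I_N}| = (N ^ n)%N.
Proof. by rewrite card_ffun !card_ord. Qed.

(** A ball of radius about [phi (N r)] is contained in the image of a cube of
    side [N r], hence is covered by the images of the [N ^ n] grid cubes of side
    [r], each of which lies in a ball of radius about [phi r]; compare
    measures. *)
Lemma image_scale_mul_le N r : (0 < N)%N -> 0 < r ->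
  phi (N%:R * r) <= 2 * A ^+ 2 * C ^+ 2 * N%:R * phi r.
Proof.
move=> N0 r0; pose I := {ffun 'I_n -> 'I_N}.
have Nr0 : 0 < N%:R * r by rewrite mulr_gt0 ?ltr0n.
pose c : euclidean R n := const_mx (N%:R * r / 2).
pose p (k : I) : euclidean R n := grid_point r k.
have sub : ball (f c) (phi (N%:R * r) / A) `<=`
    \bigcup_(k in [set` enum I]) ball (f (p k)) (2 * A * phi r).
  move=> y; have [x <-] := f_surj y; rewrite ballEmdist/= => fcx.
  have xc : mdist x c < N%:R * r / 2.
    rewrite ltNge; apply/negP => cx.
    have : phi (N%:R * r) <= A * mdist (f c) (f x).
      apply: image_scale_le; first exact: ltW.
      apply: le_dim; first exact: mdist_ge0.
      by rewrite metric_sym; lra.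
    by rewrite leNgt -ltr_pdivlMl// mulrC fcx.
  have [k xk] := grid_approx n0 r0 xc.
  exists k; first by rewrite /= mem_enum.
  rewrite ballEmdist/=; apply: (@le_lt_trans _ _ (A * phi r)).
    apply: le_image_scale; first exact: ltW.
    rewrite metric_sym; apply: le_trans xk _.
    by rewrite natrM -mulrA ler_peMl ?mulr_ge0 ?(ltW r0)// ler1n.
  by rewrite -mulrA ltr_pMl ?mulr_gt0 ?image_scale_gt0// ltr1n.
have phiNr0 : 0 < phi (N%:R * r) / A by rewrite divr_gt0 ?image_scale_gt0.
have phir0 : 0 < 2 * A * phi r by rewrite !mulr_gt0 ?image_scale_gt0.
have /andP[lower _] := mu_ball (f c) phiNr0.
have /(le_trans lower) := hausdorff_measure_mono n sub.
move=> /le_trans/(_ (hausdorff_measure_bigcup_le _ _ n0)).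
have upper k (_ : true) :
    (hausdorff_measure n (ball (f (p k)) (2 * A * phi r)) <=
     (C * (2 * A * phi r) ^+ n)%:E)%E.
  by case/andP: (mu_ball (f (p k)) phir0).
move=> /le_trans/(_ (lee_sum _ upper)).
rewrite sumEFin lee_fin big_const_seq count_predT -cardE grid_card iter_addr_0.
rewrite -[leRHS]mulr_natl natrX => H.
suff : phi (N%:R * r) / A <= C ^+ 2 * (N%:R * (2 * A * phi r)).
  by rewrite ler_pdivrMr// => /le_trans; apply; lra.
apply: (@ler_root_bound _ n) => //.
- by rewrite exprn_ege1.
- exact: ltW.
- by rewrite mulr_ge0// ltW.
rewrite [in leRHS]exprMn expr2 -mulrA (mulrCA C (_ ^+ n)); move: H.
by rewrite ler_pdivrMl.
Qed.

(** The [N ^ n] grid points of step [r] have images which are the centers of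
    separated balls of radius about [phi r], all inside one ball of radius about
    [phi (N r)]; compare measures. *)
Lemma mul_image_scale_le N r : (0 < N)%N -> 0 < r ->
  N%:R * phi r <= 9 * A ^+ 2 * C ^+ 2 * phi (N%:R * r).
Proof.
move=> N0 r0; pose I := {ffun 'I_n -> 'I_N}.
have N1 : 1 <= N%:R :> R by rewrite ler1n.
have Nr0 : 0 < N%:R * r by rewrite mulr_gt0 ?ltr0n.
have phiNr0 := image_scale_gt0 Nr0; have phir0 := image_scale_gt0 r0.
pose p (k : I) : euclidean R n := grid_point r k.
pose s := phi r / (3 * A); have s0 : 0 < s by rewrite divr_gt0 ?mulr_gt0.
have sE : phi r = 3 * (A * s) by rewrite /s; field; rewrite gt_eqF.
have sub : \bigcup_(k in [set` enum I]) ball (f (p k)) s `<=`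
    ball (f 0) (3 * A * phi (N%:R * r)).
  move=> y [k _]; rewrite !ballEmdist/= => fky.
  have f0k : mdist (f 0) (f (p k)) <= A * phi (N%:R * r).
    apply: le_image_scale; first exact: ltW.
    apply: le_trans (dist_grid_origin k n0 (ltW r0)) _.
    by rewrite natrM -mulrA ler_peMl ?mulr_ge0 ?(ltW r0)// ler1n.
  have phi_mono : phi r <= A * phi (N%:R * r).
    apply: image_scale_le2; [exact: ltW|exact: ltW|].
    by apply: le_dim; [exact: ltW|nra].
  have := metric_triangle (f 0) (f (p k)) y.
  have : s <= A * s by rewrite ler_peMl// ltW.
  by rewrite -mulrA; have := mulr_gt0 A0 phiNr0; lra.
have sep k l x y : k != l -> ball (f (p k)) s x -> ball (f (p l)) s y ->
    s <= mdist x y.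
  move=> kl; rewrite !ballEmdist/= => kx ly.
  (* The centers are at distance at least [3 s], and each ball takes up less
     than [s] of it. *)
  have : phi r <= A * mdist (f (p k)) (f (p l)).
    apply: image_scale_le; first exact: ltW.
    apply: le_dim; first exact: mdist_ge0.
    have : r <= mdist (p k) (p l) by exact: dist_grid_ge (ltW r0) kl.
    by lra.
  rewrite sE mulrCA ler_pM2l// => kl3.
  have := metric_triangle (f (p k)) x (f (p l)).
  have := metric_triangle x y (f (p l)).
  by rewrite (metric_sym y); lra.
have big0 : 0 < 3 * A * phi (N%:R * r) by rewrite !mulr_gt0.
have /andP[_] := mu_ball (f 0) big0.
move=> /(le_trans (hausdorff_measure_mono n sub)).
move=> /(le_trans (hausdorff_measure_bigcup_separated n0 s0 (enum_uniq _) sep)).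
have lower k (_ : true) :
    ((C^-1 * s ^+ n)%:E <= hausdorff_measure n (ball (f (p k)) s))%E.
  by case/andP: (mu_ball (f (p k)) s0).
move=> /(le_trans (lee_sum _ lower)).
rewrite sumEFin lee_fin big_const_seq count_predT -cardE grid_card iter_addr_0.
rewrite -[leLHS]mulr_natl natrX mulrCA -exprMn ler_pdivrMl// (mulrA C C) -expr2.
move=> /(ler_root_bound n0) H; rewrite sE.
have {}H : N%:R * s <= C ^+ 2 * (3 * A * phi (N%:R * r)).
  by apply: H; [exact: exprn_ege1|rewrite mulr_ge0//|]; exact: ltW.
have := ler_wpM2l (ltW (mulr_gt0 (ltr0Sn R 2) A0)) H.
by congr (_ <= _); ring.
Qed.

Let D := 18 * A ^+ 3 * C ^+ 2.

Let D0 : 0 < D. Proof. by rewrite !mulr_gt0 ?exprn_gt0. Qed.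

(** With [N] the integer part of [t / s], the scales [N s] and [t] are
    comparable, and [N] is comparable to [t / s]. *)
Lemma image_scale_linear s t : 0 < s -> 0 < t -> t * phi s <= D * (s * phi t).
Proof.
(* The two estimates exchange roles when [s] and [t] do. *)
suff aux u v : 0 < u -> u <= v ->
    u * phi v <= D * (v * phi u) /\ v * phi u <= D * (u * phi v).
  by move=> s0 t0; case: (leP s t) => [st|/ltW ts];
    [case: (aux _ _ s0 st)|case: (aux _ _ t0 ts)].
move=> u0 uv; have v0 : 0 < v by exact: lt_le_trans uv.
have vu0 : 0 <= v / u by rewrite divr_ge0 ?ltW.
have /andP[] := truncn_itv vu0; set N := Num.truncn _.
rewrite ler_pdivlMr// ltr_pdivrMr// -natr1 => Nu_le v_lt.
have N0 : (0 < N)%N.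
  by rewrite lt0n; apply: contraTneq v_lt => ->; rewrite -leNgt add0r mul1r.
have N1 : 1 <= N%:R :> R by rewrite ler1n.
have Nu0 : 0 < N%:R * u by rewrite mulr_gt0 ?ltr0n.
have v_le : v <= 2 * (N%:R * u) by nra.
have vN : phi v <= A * phi (N%:R * u).
  by apply: image_scale_le2; [exact: ltW|exact: ltW|apply: le_dim; lra].
have Nv : phi (N%:R * u) <= A * phi v.
  by apply: image_scale_le2; [exact: ltW|exact: ltW|apply: le_dim; lra].
have Nle := image_scale_mul_le N0 u0; have leN := mul_image_scale_le N0 u0.
have phiu0 := image_scale_ge0 u; have phiv0 := image_scale_ge0 v.
have A20 : 0 < A ^+ 2 by rewrite exprn_gt0.
have C20 : 0 < C ^+ 2 by rewrite exprn_gt0.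
have DE : D = 18 * (A * (A ^+ 2 * C ^+ 2)) by rewrite /D; ring.
have E0 : 0 < A ^+ 2 * C ^+ 2 by rewrite mulr_gt0.
move: Nle leN; rewrite -!(mulrA _ (A ^+ 2)).
set E := A ^+ 2 * C ^+ 2 in E0 DE * => Nle leN; split.
  apply: (@le_trans _ _ (u * (A * (2 * E * N%:R * phi u)))).
    rewrite ler_wpM2l ?(ltW u0)//; apply: le_trans vN _.
    by rewrite ler_wpM2l// ltW.
  have -> : u * (A * (2 * E * N%:R * phi u)) = 2 * (A * E) * (N%:R * u * phi u).
    by ring.
  rewrite DE; apply: ler_pM.
  - by rewrite !mulr_ge0// ltW.
  - by rewrite !mulr_ge0// ltW.
  - by rewrite ler_pM2r ?mulr_gt0// ler_nat.
  - by rewrite ler_wpM2r.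
apply: (@le_trans _ _ (2 * u * (N%:R * phi u))).
  by have := ler_wpM2r phiu0 v_le; congr (_ <= _); ring.
apply: (@le_trans _ _ (2 * u * (9 * E * (A * phi v)))).
  rewrite ler_wpM2l ?mulr_ge0 ?(ltW u0)//; apply: le_trans leN _.
  by rewrite ler_wpM2l// mulr_ge0// ltW.
by rewrite DE; lra.
Qed.

Lemma bilipschitz_of_linear_scale : bilipschitz f.
Proof.
have phi1 : 0 < phi 1 by exact: image_scale_gt0.
have a0 : 0 < A * D * phi 1 by rewrite !mulr_gt0.
have b0 : 0 < A * D / phi 1 by rewrite divr_gt0 ?mulr_gt0.
pose L := 1 + A * D * phi 1 + A * D / phi 1.
have L1 : 1 <= L by rewrite /L; lra.
exists L => // x y; have [->|xy] := eqVneq x y.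
  by rewrite !mdistxx !mulr0 lexx.
have d0 : 0 < mdist x y by rewrite mdist_gt0.
have L0 : 0 < L by exact: lt_le_trans L1.
have lip_up : mdist (f x) (f y) <= A * phi (mdist x y).
  by apply: le_image_scale; [exact: ltW|apply: le_dim; lra].
have lip_lo : phi (mdist x y) <= A * mdist (f x) (f y).
  by apply: image_scale_le; [exact: ltW|apply: le_dim; lra].
have up := image_scale_linear d0 ltr01; have lo := image_scale_linear ltr01 d0.
apply/andP; split.
  rewrite ler_pdivrMl//.
  apply: (@le_trans _ _ (A * D / phi 1 * mdist (f x) (f y))).
    rewrite mulrAC ler_pdivlMr//; apply: le_trans lo _.
    by rewrite mul1r (mulrC A) -(mulrA D) ler_wpM2l// ltW.
  by rewrite ler_wpM2r ?mdist_ge0// /L; lra.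
apply: (le_trans lip_up); apply: (@le_trans _ _ (A * D * phi 1 * mdist x y)).
  rewrite -(mulrA A D) -(mulrA A) ler_wpM2l ?(ltW A0)//.
  move: up; rewrite mul1r => /le_trans; apply.
  by rewrite -(mulrA D) (mulrC (phi 1)).
by rewrite ler_wpM2r ?ltW// /L; lra.
Qed.

End LinearGrowth.

(** * Bi-Lipschitz maps and quasihomogeneous maps *)

Lemma homeomorphism_on_scale (R : realType) (a : R) : 0 < a ->
  homeomorphism_on (`[0, +oo[%classic : set R) (`[0, +oo[%classic : set R)
    ( *%R a).
Proof.
move=> a0; exists ( *%R a^-1); split.
- by move=> x /=; rewrite !in_itv/= !andbT; exact: mulr_ge0 (ltW a0).
- move=> x /=; rewrite !in_itv/= !andbT.
  by apply: mulr_ge0; rewrite invr_ge0 ltW.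
- by move=> x _; rewrite mulKf// gt_eqF.
- by move=> x _; rewrite mulVKf// gt_eqF.
- by split; apply: continuous_subspaceT => x; exact: mulrl_continuous.
Qed.

Lemma bilipschitz_ratio (R : realType) (X Y : metricType R) (f : X -> Y) (L : R)
    (x y z w : X) : 1 <= L ->
  (forall x y, L^-1 * mdist x y <= mdist (f x) (f y) <= L * mdist x y) ->
  z != w ->
  mdist (f x) (f y) / mdist (f z) (f w) <= L ^+ 2 * (mdist x y / mdist z w).
Proof.
move=> L1 fL zw; have L0 : 0 < L by exact: lt_le_trans L1.
have zw0 : 0 < mdist z w by rewrite mdist_gt0.
have /andP[lo _] := fL z w; have /andP[_ up] := fL x y.
have lo0 : 0 < L^-1 * mdist z w by rewrite mulr_gt0 ?invr_gt0.
apply: (@le_trans _ _ (L * mdist x y / (L^-1 * mdist z w))).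
  apply: ler_pM => //; rewrite ?mdist_ge0 ?invr_ge0 ?mdist_ge0//.
  by rewrite lef_pV2 ?posrE// (lt_le_trans lo0).
rewrite le_eqVlt; apply/orP; left; apply/eqP; field.
by rewrite !gt_eqF.
Qed.

Theorem theorem2p2 (R : realType) (n : nat) (hn : (1 <= n)%N)
    (X : metricType R) (hX : ahlfors_regular n X)
    (f : euclidean R n -> X) (hf : homeomorphism f) :
  quasihomogeneous f <-> bilipschitz f.
Proof.
case: (hf) => g [_ _ fK gK [f_cont g_cont]].
split=> [f_qh|[L L1 fL]].
  have [C C1 mu_ball] := hX.
  have K1 : 1 <= (2 * n)%:R :> R by rewrite ler1n muln_gt0.
  have [A A1 f_compare] := quasihomogeneous_compare hn K1 f_qh.
  apply: (bilipschitz_of_linear_scale hn A1 C1 _ _ f_compare mu_ball).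
    by move=> x y fxy; rewrite -(fK x) ?inE// fxy fK ?inE.
  by move=> y; exists (g y); rewrite gK ?inE.
split.
  rewrite /embedding; have -> : range f = setT.
    by rewrite -subTset => y _; exists (g y) => //; rewrite gK ?inE.
  exact: hf.
exists ( *%R (L ^+ 2)).
  by apply: homeomorphism_on_scale; rewrite exprn_gt0// (lt_le_trans _ L1).
move=> x y z w u; apply: bilipschitz_ratio => //.
by move: u => /= /and4P[_ _]; rewrite inE.
Qed.
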